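(* For every $n\ge 4$ and every $n\times n$ complex unitary matrix $U$, $$\delta_1(U)\le\delta_2(U)\le\cdots\le\delta_{\lfloor n/2\rfloor}(U),$$ and moreover $\delta_r(U)=\delta_{n-r}(U)$ for all $0\le r\le n$.
   Context: Notation: $[n]=\{1,\dots,n\}$, $N_{n,r}=\binom{n}{r}$, and $U[I,J]$ is the submatrix of $U$ with row set $I$ and column set $J$. For an $n\times n$ unitary matrix $U$ and $1\le r\le n$, the $r$-th uniform-minor discrepancy is $$\delta_r(U)=\sum_{\substack{I,J\subset[n]\\|I|=|J|=r}}\left(|\det U[I,J]|^2-\frac{1}{N_{n,r}}\right)^2,$$ and $\delta_0(U)=0$. *)

(* Defs.v *)
From mathcomp Require Import all_boot all_order all_algebra spectral.
From mathcomp Require Import complex reals.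

Set Implicit Arguments.
Unset Strict Implicit.
Unset Printing Implicit Defensive.

Import GRing.Theory.
Local Open Scope ring_scope.
Local Open Scope complex_scope.

(* U[I, J]; [enum_val] lists the elements of a set of ordinals in increasing
   order. *)
Definition setsubmx (K : Type) (n : nat) (U : 'M[K]_n) (I J : {set 'I_n}) :
    'M[K]_(#|I|, #|J|) :=
  mxsub enum_val enum_val U.

(* det U[I, J] when #|I| = #|J| = r. The dimensions #|I| and #|J| of U[I, J] are
   only propositionally equal to r, so that taking a determinant requires a
   cast; the default matrix 0 is used only when one of them differs from r. *)
Definition setminor (K : comPzRingType) (n r : nat) (U : 'M[K]_n)
    (I J : {set 'I_n}) : K :=
  \det (conform_mx (0 : 'M[K]_r) (setsubmx U I J)).

Lemma setminorE (K : comPzRingType) (n r : nat) (U : 'M[K]_n)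
    (I J : {set 'I_n}) (cI : #|I| = r) (cJ : #|J| = r) :
  setminor r U I J =
    \det (\matrix_(i < r, j < r)
            U (enum_val (cast_ord (esym cI) i)) (enum_val (cast_ord (esym cJ) j))).
Proof.
rewrite /setminor; congr (\det _).
rewrite -(conform_castmx (cI, cJ)) conform_mx_id.
by apply/matrixP => i j; rewrite castmxE !mxE.
Qed.

Definition minor_discrepancy (R : realType) (n : nat) (U : 'M[R[i]]_n)
    (r : nat) : R :=
  if r == 0%N then 0 else
  \sum_(I : {set 'I_n} | #|I| == r) \sum_(J : {set 'I_n} | #|J| == r)
    (ComplexField.Normc.normc (setminor r U I J) ^+ 2 - ('C(n, r)%:R)^-1) ^+ 2.

(* Main.v *)
Require Import Defs.
From mathcomp Require Import all_boot all_order all_algebra all_fingroup spectral.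
From mathcomp Require Import complex reals.

Set Implicit Arguments.
Unset Strict Implicit.
Unset Printing Implicit Defensive.

Import Order.TTheory GRing.Theory Num.Theory.
Local Open Scope ring_scope.
Local Open Scope complex_scope.

(** Write P_r for the square matrix, indexed by the r-subsets of [n], with
entries |det U[I, J]|^2.  Its columns sum to 1, so expanding the square gives
delta_r(U) = tr(P_r P_r^T) - 1, and both claims become statements on P_r.

The key point is that the matrices P_r for consecutive r are intertwined by the
inclusion matrix X (rows: (r+1)-subsets, columns: r-subsets):
  X^T P_(r+1) = P_r X^T   and   P_(r+1) X = X P_r.
The second identity is the transpose of the first for U^T.  The first
([minor_intertwining]) says that, for #|I| = r and #|J| = r + 1,
  sum_(k not in I) |det U[I + k, J]|^2 = sum_(l in J) |det U[I, J - l]|^2.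
To see this, put row k on top of the rows of I and expand along it: the
determinant is sum_l U_(k, l) c_l, where c_l = +- det U[I, J - l] does not
depend on k.  Summing over all k (those in I contribute 0) gives |B c|^2, where
B consists of the columns of U in J; these are orthonormal, so the sum is |c|^2.

When 0 < r and 2r < n the Gram matrix X^T X is invertible ([gram_incl_mx]), being the sum
of the positive scalar n - 2r and of a Gram matrix one level lower.  Thus P_r
is carried by an orthogonal change of basis to the restriction of P_(r+1) to the
column space of X, a space stable under P_(r+1) and P_(r+1)^T, and the Frobenius
norm can only grow from P_r to P_(r+1) ([trace_intertwiner]).

The symmetry r <-> n - r comes from Jacobi's complementary minor identity:
for a unitary matrix, |det U[I, J]| = |det U[~I, ~J]| ([norm_setminorC]). *)

(** * Subsets differing by one element *)

Lemma sum_covers (V : nmodType) (T : finType) (r : nat) (I : {set T})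
    (F : {set T} -> V) : #|I| = r ->
  \sum_(K : {set T} | (#|K| == r.+1) && (I \subset K)) F K =
  \sum_(k | k \notin I) F (k |: I).
Proof.
move=> cI; pose h k := k |: I.
have h_inj : {in ~: I &, injective h}.
  move=> k l; rewrite !inE => kI lI /setP/(_ k).
  by rewrite !inE eqxx (negbTE kI) !orbF => /esym/eqP.
transitivity (\sum_(k in ~: I) F (h k)); last by apply: eq_bigl => k; rewrite inE.
rewrite -(big_imset F h_inj); apply: eq_bigl => K. apply/andP/imsetP.
  case=> /eqP cK sIK; have /cards1P[k Dk] : #|K :\: I| == 1%N.
    by rewrite cardsDS // cK cI subSnn.
  exists k; last by rewrite /h -Dk setUC -[X in X :|: _](setIidPr sIK) setID.
  by have := set11 k; rewrite -Dk !inE => /andP[].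
case=> k; rewrite inE => kI ->; split; last exact: subsetUr.
by rewrite cardsU1 kI cI.
Qed.

Lemma sum_cocovers (V : nmodType) (T : finType) (r : nat) (J : {set T})
    (F : {set T} -> V) : #|J| = r.+1 ->
  \sum_(L : {set T} | (#|L| == r) && (L \subset J)) F L =
  \sum_(l in J) F (J :\ l).
Proof.
move=> cJ; have h_inj : {in J &, injective (fun l => J :\ l)}.
  move=> k l kJ lJ /setP/(_ k).
  by rewrite !inE eqxx kJ !andbT /= => /esym/negbFE/eqP.
rewrite -(big_imset F h_inj); apply: eq_bigl => L; apply/andP/imsetP.
  case=> /eqP cL sLJ; have /cards1P[k Dk] : #|J :\: L| == 1%N.
    by rewrite cardsDS // cJ cL subSnn.
  exists k; last by rewrite -Dk setDDr setDv set0U (setIidPr sLJ).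
  by have := set11 k; rewrite -Dk !inE => /andP[].
case=> k kJ ->; split; last exact: subsetDl.
by move: cJ; rewrite (cardsD1 k) kJ add1n => -[->].
Qed.

(** * Minors of a unitary matrix *)

Section Minors.

Variable (C : numClosedFieldType) (n : nat).
Implicit Types (U : 'M[C]_n) (I J : {set 'I_n}).

Lemma enumeration_perm (r : nat) (f : 'I_r -> 'I_n) I (cI : #|I| = r) :
  injective f -> (forall i, f i \in I) ->
  exists s : 'S_r, forall i, f i = enum_val (cast_ord (esym cI) (s i)).
Proof.
move=> f_inj fI; pose h i := cast_ord cI (enum_rank_in (fI i) (f i)).
have hE i : enum_val (cast_ord (esym cI) (h i)) = f i.
  by rewrite cast_ordK enum_rankK_in.
have h_inj : injective h by move=> i j hij; apply: f_inj; rewrite -!hE hij.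
by exists (perm h_inj) => i; rewrite permE hE.
Qed.

(** Up to sign a minor does not depend on the order of its rows and columns;
taking norms allows any convenient enumeration of [I] and [J]. *)
Lemma norm_setminor (r : nat) U I J (f g : 'I_r -> 'I_n) :
  #|I| = r -> #|J| = r -> injective f -> injective g ->
  (forall i, f i \in I) -> (forall j, g j \in J) ->
  `|setminor r U I J| = `|\det (mxsub f g U)|.
Proof.
move=> cI cJ f_inj g_inj fI gJ; rewrite (setminorE _ cI cJ).
have [s fE] := enumeration_perm cI f_inj fI.
have [t gE] := enumeration_perm cJ g_inj gJ.
set A := (\matrix_(_, _) _).
have -> : mxsub f g U = row_perm s (col_perm t A).
  by apply/matrixP => i j; rewrite !mxE fE gE.
rewrite row_permE col_permE !det_mulmx !det_perm !normrM !normrX !normrN1.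
by rewrite !expr1n mul1r mulr1.
Qed.

Lemma setminor_tr (r : nat) U I J : #|I| = r -> #|J| = r ->
  setminor r U^T I J = setminor r U J I.
Proof.
move=> cI cJ; rewrite (setminorE _ cI cJ) (setminorE _ cJ cI) -[RHS]det_tr.
by congr (\det _); apply/matrixP => i j; rewrite !mxE.
Qed.

Lemma isometry_norm (k m : nat) (B : 'M[C]_(m, k)) (c : 'I_k -> C) :
  B^T \is unitarymx ->
  \sum_i `|\sum_l B i l * c l| ^+ 2 = \sum_l `|c l| ^+ 2.
Proof.
move=> /unitarymxP BB.
under eq_bigr => i _.
  rewrite normCK rmorph_sum mulr_suml.
  under eq_bigr => l _ do rewrite mulr_sumr.
  over.
rewrite exchange_big; apply: eq_bigr => l _ /=; rewrite exchange_big /=.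
rewrite (bigD1 l) //= [X in _ + X]big1 ?addr0 => [|j jl].
  under eq_bigr => i _ do rewrite rmorphM mulrACA.
  rewrite -mulr_suml -normCK; have /matrixP/(_ l l) := BB.
  rewrite !mxE eqxx; under eq_bigr => i _ do rewrite !mxE.
  by move=> ->; rewrite mul1r.
under eq_bigr => i _ do rewrite rmorphM mulrACA.
rewrite -mulr_suml; have /matrixP/(_ l j) := BB.
rewrite !mxE eq_sym (negbTE jl); under eq_bigr => i _ do rewrite !mxE.
by move=> ->; rewrite mul0r.
Qed.

(** Laplace expansion along the added row [k] writes the minor on the rows
[k |: I] as the [k]-th entry of [B *m c], where [B] is the isometry formed by
the columns in [J] and [c] lists the cofactors, which are minors on the rows
[I]. *)
Lemma minor_intertwining (r : nat) U I J : U \is unitarymx ->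
  #|I| = r -> #|J| = r.+1 ->
  \sum_(K : {set 'I_n} | (#|K| == r.+1) && (I \subset K))
     `|setminor r.+1 U K J| ^+ 2 =
  \sum_(L : {set 'I_n} | (#|L| == r) && (L \subset J))
     `|setminor r U I L| ^+ 2.
Proof.
move=> U_unitary cI cJ; rewrite sum_covers // sum_cocovers //.
pose f i : 'I_n := enum_val (cast_ord (esym cI) i).
pose g j : 'I_n := enum_val (cast_ord (esym cJ) j).
have f_inj : injective f by move=> i j /enum_val_inj/cast_ord_inj.
have g_inj : injective g by move=> i j /enum_val_inj/cast_ord_inj.
have fI i : f i \in I by apply: enum_valP.
have gJ j : g j \in J by apply: enum_valP.
pose c (l : 'I_r.+1) := (-1) ^+ l * \det (mxsub f (g \o lift l) U).
(* [k] on top of the enumeration of [I]; not injective when [k \in I]. *)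
pose fk k (i : 'I_r.+1) := if unlift ord0 i is Some i' then f i' else k.
have fk0 k : fk k ord0 = k by rewrite /fk unlift_none.
have fkS k i : fk k (lift ord0 i) = f i by rewrite /fk liftK.
have det_fk k : \det (mxsub (fk k) g U) = \sum_l U k (g l) * c l.
  rewrite (expand_det_row _ ord0); apply: eq_bigr => l _.
  rewrite mxE fk0 /cofactor add0n; congr (_ * (_ * \det _)).
  by apply/matrixP => i j; rewrite !mxE fkS.
have fk_inj k : k \notin I -> injective (fk k).
  move=> kI i j; case: (unliftP ord0 i) => [i'|] ->;
    case: (unliftP ord0 j) => [j'|] ->; rewrite ?fk0 ?fkS //.
  - by move=> /f_inj ->.
  - by move=> fik; rewrite -fik fI in kI.
  - by move=> fik; rewrite fik fI in kI.
transitivity (\sum_k `|\sum_l U k (g l) * c l| ^+ 2).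
  rewrite [RHS](bigID (mem I)) /= [X in _ = X + _]big1 ?add0r => [|k kI].
    apply: eq_bigr => k kI; rewrite -det_fk.
    rewrite (norm_setminor U (f := fk k) (g := g)) //.
    - by rewrite cardsU1 kI cI.
    - exact: fk_inj.
    - move=> i; case: (unliftP ord0 i) => [i'|] ->; rewrite ?fk0 ?fkS ?setU11 //.
      by rewrite setU1r.
  (* For [k \in I] the row [k] occurs twice. *)
  have [i' fi'] : exists i', f i' = k.
    exists (cast_ord cI (enum_rank_in kI k)).
    by rewrite /f cast_ordK enum_rankK_in.
  rewrite -det_fk (@determinant_alternate _ _ _ ord0 (lift ord0 i')) ?normr0 ?expr0n //.
  by move=> j; rewrite !mxE fk0 fkS fi'.
have gU_unitary : (colsub g U)^T \is unitarymx.
  apply/unitarymxP/matrixP => i j; rewrite !mxE.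
  have /unitarymxP/matrixP/(_ (g i) (g j)) : U^T \is unitarymx.
    by rewrite trmx_unitary.
  rewrite !mxE (inj_eq g_inj) => <-.
  by apply: eq_bigr => k _; rewrite !mxE.
have := isometry_norm c gU_unitary.
under eq_bigr => k _ do under eq_bigr => l _ do rewrite mxE.
move=> ->.
pose g' k := cast_ord cJ (enum_rank_in (gJ ord0) k).
rewrite (reindex_onto g g') /=; last first.
  by move=> k kJ; rewrite /g cast_ordK enum_rankK_in.
apply: eq_big => [l|l _].
  by rewrite gJ; apply/esym/eqP/g_inj; rewrite {1}/g cast_ordK enum_rankK_in.
rewrite (norm_setminor U (f := f) (g := g \o lift l)) //.
- by rewrite /c normrM normrX normrN1 expr1n mul1r.
- by have := cardsD1 (g l) J; rewrite gJ cJ add1n => -[].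
- by move=> i j /g_inj/lift_inj.
- by move=> j; rewrite !inE gJ (inj_eq g_inj) eq_sym neq_lift.
Qed.

(** Jacobi's complementary minor identity. Listing [I], [J] before their
complements turns [U] into a unitary block matrix [V]; with [W] its adjoint,
[V *m W = 1] gives a factorization in which [V] times a block triangular
matrix of determinant [\det (drsubmx W)] has determinant [\det (ulsubmx V)]. *)
Lemma norm_setminorC (r m : nat) U I J : U \is unitarymx ->
  #|I| = r -> #|J| = r -> (r + m)%N = n ->
  `|setminor r U I J| = `|setminor m U (~: I) (~: J)|.
Proof.
move=> U_unitary cI cJ rm.
have cC (A : {set 'I_n}) : #|A| = r -> #|~: A| = m.
  by move=> cA; apply/eqP; rewrite -(eqn_add2l r) rm -{1}cA cardsC card_ord.
pose f (A : {set 'I_n}) (cA : #|A| = r) (i : 'I_(r + m)) : 'I_n :=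
  match split i with
  | inl a => enum_val (cast_ord (esym cA) a)
  | inr b => enum_val (cast_ord (esym (cC A cA)) b)
  end.
have f_l (A : {set 'I_n}) (cA : #|A| = r) a :
    f A cA (lshift m a) = enum_val (cast_ord (esym cA) a).
  by rewrite /f (unsplitK (inl _ a)).
have f_r (A : {set 'I_n}) (cA : #|A| = r) b :
    f A cA (rshift r b) = enum_val (cast_ord (esym (cC A cA)) b).
  by rewrite /f (unsplitK (inr _ b)).
have f_bij (A : {set 'I_n}) (cA : #|A| = r) : bijective (f A cA).
  apply: inj_card_bij; last by rewrite !card_ord rm.
  move=> i j; case: (split_ordP i) => a ->; case: (split_ordP j) => b ->;
    rewrite ?f_l ?f_r.
  - by move=> /enum_val_inj/cast_ord_inj ->.
  - move=> ab; have := enum_valP (cast_ord (esym (cC A cA)) b).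
    by rewrite -ab inE enum_valP.
  - move=> ab; have := enum_valP (cast_ord (esym (cC A cA)) a).
    by rewrite ab inE enum_valP.
  - by move=> /enum_val_inj/cast_ord_inj ->.
pose V := mxsub (f I cI) (f J cJ) U.
have V_unitary : V \is unitarymx.
  apply/unitarymxP/matrixP => i j; rewrite !mxE.
  have /unitarymxP/matrixP/(_ (f I cI i) (f I cI j)) := U_unitary.
  rewrite !mxE (inj_eq (bij_inj (f_bij _ cI))) => <-.
  rewrite (reindex (f J cJ)) /=; last exact: onW_bij.
  by apply: eq_bigr => k _; rewrite !mxE.
rewrite (norm_setminor U (f := f I cI \o lshift m) (g := f J cJ \o lshift m)) //;
  first last.
- by move=> i; rewrite /= f_l enum_valP.
- by move=> i; rewrite /= f_l enum_valP.
- by apply: inj_comp; [exact: bij_inj | exact: lshift_inj].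
- by apply: inj_comp; [exact: bij_inj | exact: lshift_inj].
rewrite (norm_setminor U (f := f I cI \o @rshift r m) (g := f J cJ \o @rshift r m));
  first last.
- by move=> i; rewrite /= f_r enum_valP.
- by move=> i; rewrite /= f_r enum_valP.
- by apply: inj_comp; [exact: bij_inj | exact: rshift_inj].
- by apply: inj_comp; [exact: bij_inj | exact: rshift_inj].
- by rewrite cC.
- by rewrite cC.
have -> : mxsub (f I cI \o lshift m) (f J cJ \o lshift m) U = ulsubmx V.
  by apply/matrixP => i j; rewrite !mxE.
have -> : mxsub (f I cI \o @rshift r m) (f J cJ \o @rshift r m) U = drsubmx V.
  by apply/matrixP => i j; rewrite !mxE.
have VV := unitarymxP V_unitary.
set W := V ^t*%sesqui in VV.
have detV : `|\det V| = 1.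
  have /(congr1 determinant) := VV; rewrite det_mulmx det1 /W det_map_mx det_tr.
  rewrite -normCK => /eqP; by rewrite sqrp_eq1 // => /eqP.
have : V *m block_mx 1%:M (ursubmx W) 0 (drsubmx W) =
       block_mx (ulsubmx V) 0 (dlsubmx V) 1%:M.
  have : block_mx (ulsubmx V) (ursubmx V) (dlsubmx V) (drsubmx V) *m
         block_mx (ulsubmx W) (ursubmx W) (dlsubmx W) (drsubmx W) =
         block_mx 1%:M 0 0 1%:M by rewrite !submxK VV scalar_mx_block.
  rewrite mulmx_block => /eq_block_mx[_ ur _ dr].
  rewrite -{1}[V]submxK mulmx_block ur dr.
  by rewrite !mulmx1 !mulmx0 !addr0.
move=> /(congr1 determinant)/(congr1 Num.norm).
rewrite det_mulmx det_ublock det_lblock !det1 mul1r mulr1 normrM detV mul1r.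
move=> <-; have -> : drsubmx W = (drsubmx V) ^t*%sesqui.
  by apply/matrixP => i j; rewrite !mxE.
by rewrite det_map_mx det_tr norm_conjC.
Qed.

End Minors.
(** * Inclusion matrices between consecutive layers of the Boolean lattice *)

Section Layers.

Variables (F : realFieldType) (n : nat).
Implicit Types I J K L : {set 'I_n}.

Definition layer (r : nat) : {set {set 'I_n}} :=
  [set I : {set 'I_n} | #|I| == r].

Definition layer_mx r s (f : {set 'I_n} -> {set 'I_n} -> F) :
    'M[F]_(#|layer r|, #|layer s|) :=
  \matrix_(i, j) f (enum_val i) (enum_val j).

Definition incl_mx r := layer_mx r.+1 r (fun J I => (I \subset J)%:R).

Lemma card_layer r (i : 'I_#|layer r|) : #|enum_val i| = r.
Proof. by have := enum_valP i; rewrite inE => /eqP. Qed.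

Lemma sum_layer r (f : {set 'I_n} -> F) :
  \sum_(i < #|layer r|) f (enum_val i) = \sum_(I : {set 'I_n} | #|I| == r) f I.
Proof. by rewrite -big_enum_val; apply: eq_bigl => I; rewrite inE. Qed.

Lemma sum_sub_set1 (D : {set 'I_n}) : D != set0 ->
  (\sum_k (D \subset [set k]) = (#|D| == 1))%N.
Proof.
move=> D0; have [/cards1P[x ->]|D1] := boolP (#|D| == 1%N).
  rewrite (bigD1 x) //= subxx big1 // => k kx.
  by rewrite sub1set inE eq_sym (negbTE kx).
rewrite big1 // => k _; apply/eqP; rewrite eqb0; apply: contra D1.
by rewrite subset1 (negbTE D0) orbF => /eqP ->; rewrite cards1.
Qed.

(** For two distinct sets of the same size, having a common cover and having a
common cocover are the same condition; hence the off-diagonal entries of the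
two Gram matrices of [gram_incl_mx] agree. *)
Lemma card_common_covers r I J : #|I| = r -> #|J| = r -> I != J ->
  (\sum_(k | k \notin I) (J \subset k |: I) = (#|I :&: J|.+1 == r))%N.
Proof.
move=> cI cJ IJ; have D0 : J :\: I != set0.
  by rewrite setD_eq0; apply: contra IJ => sJI; rewrite eq_sym eqEcard sJI cI cJ /=.
have -> : (#|I :&: J|.+1 == r) = (#|J :\: I| == 1%N).
  by rewrite -[r in LHS]cJ -(cardsID I J) setIC -addn1 eqn_add2l eq_sym.
rewrite -sum_sub_set1 // [RHS](bigID (mem I)) /= [X in _ = (X + _)%N]big1 ?add0n.
  by apply: eq_bigr => k _; rewrite subDset setUC.
move=> k kI; apply/eqP; rewrite eqb0 subset1 (negbTE D0) orbF.
by apply: contraTneq kI => /setP/(_ k); rewrite !inE eqxx => /andP[].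
Qed.

Lemma card_common_cocovers r I J : #|I| = r -> #|J| = r -> I != J ->
  (\sum_(l in I) (I :\ l \subset J) = (#|I :&: J|.+1 == r))%N.
Proof.
move=> cI cJ IJ; have D0 : I :\: J != set0.
  by rewrite setD_eq0; apply: contra IJ => sIJ; rewrite eqEcard sIJ cI cJ /=.
have -> : (#|I :&: J|.+1 == r) = (#|I :\: J| == 1%N).
  by rewrite -[r in LHS]cI -(cardsID J I) -addn1 eqn_add2l eq_sym.
rewrite -sum_sub_set1 // [RHS](bigID (mem I)) /= [X in _ = (_ + X)%N]big1 ?addn0.
  by apply: eq_bigr => k _; rewrite !subDset setUC.
move=> k kI; apply/eqP; rewrite eqb0 subset1 (negbTE D0) orbF.
by apply: contraNneq kI => /setP/(_ k); rewrite !inE eqxx => /andP[].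
Qed.

(** The commutation relation of the raising and lowering operators of the
Boolean lattice. Off the diagonal both sides count common neighbours; on it, an
[r.+1]-set has [n - r.+1] covers and [r.+1] cocovers. *)
Lemma gram_incl_mx r :
  (incl_mx r.+1)^T *m incl_mx r.+1 =
  (n%:R - (r.+1).*2%:R)%:M + incl_mx r *m (incl_mx r)^T.
Proof.
apply/matrixP => i j; rewrite !mxE.
set I := enum_val i; set J := enum_val j.
have cI : #|I| = r.+1 by apply: card_layer.
have cJ : #|J| = r.+1 by apply: card_layer.
transitivity ((\sum_(k | k \notin I) (J \subset k |: I))%N%:R : F).
  rewrite natr_sum -(sum_covers (fun K => (J \subset K)%:R) cI) big_mkcondr.
  rewrite -sum_layer; apply: eq_bigr => k _; rewrite !mxE.
  by rewrite -/I -/J; case: (I \subset _); rewrite ?mul1r ?mul0r.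
transitivity ((n%:R - (r.+1).*2%:R) *+ (i == j) +
              (\sum_(l in I) (I :\ l \subset J))%N%:R : F); last first.
  congr (_ + _); rewrite natr_sum -(sum_cocovers (fun L => (L \subset J)%:R) cI).
  rewrite big_mkcondr -sum_layer; apply: eq_bigr => k _; rewrite !mxE.
  by rewrite -/I -/J; case: (_ \subset I); rewrite ?mul1r ?mul0r.
have [ij|ij] := eqVneq i j.
  rewrite /J -ij -/I mulr1n.
  under eq_bigr => k _ do rewrite subsetUr.
  under [in RHS]eq_bigr => k _ do rewrite subsetDl.
  rewrite !sum1_card cI -[n in RHS]card_ord -(cardsC I) cI.
  rewrite (eq_card (B := ~: I)) => [|k]; last by rewrite inE.
  by rewrite -addnn !natrD addrAC opprD addrA addrAC addrK addrC addKr.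
have IJ : I != J by rewrite (inj_eq enum_val_inj).
by rewrite (card_common_covers cI cJ IJ) (card_common_cocovers cI cJ IJ) mulr0n add0r.
Qed.

End Layers.

(** * Frobenius norms of intertwined matrices *)

Section Trace.

Variable F : realFieldType.

Lemma trace_mul_tr_ge0 a b (A : 'M[F]_(a, b)) : 0 <= \tr (A *m A^T).
Proof.
rewrite /mxtrace sumr_ge0 // => i _; rewrite mxE sumr_ge0 // => j _.
by rewrite mxE -expr2 sqr_ge0.
Qed.

Lemma trace_mul_tr_eq0 a b (A : 'M[F]_(a, b)) : \tr (A *m A^T) = 0 -> A = 0.
Proof.
move=> trA; apply/matrixP => i j; rewrite mxE.
have A2 k l : 0 <= A k l * A^T l k by rewrite mxE -expr2 sqr_ge0.
have Ai k : 0 <= (A *m A^T) k k by rewrite mxE sumr_ge0.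
have := psumr_eq0P (fun k _ => Ai k) trA (i := i) isT.
rewrite mxE => /(psumr_eq0P (fun l _ => A2 i l)) /(_ j isT).
by rewrite mxE => /eqP; rewrite -expr2 sqrf_eq0 => /eqP.
Qed.

Lemma shifted_gram_unit a b (c : F) (X : 'M[F]_(a, b)) : 0 < c ->
  c%:M + X *m X^T \in unitmx.
Proof.
move=> c0; rewrite -row_free_unit -kermx_eq0; apply/eqP.
set v := kermx _; have vG : v *m (c%:M + X *m X^T) = 0 by apply: mulmx_ker.
apply: trace_mul_tr_eq0; apply/eqP; rewrite eq_le trace_mul_tr_ge0 andbT.
rewrite -(pmulr_rle0 _ c0) -mxtraceZ -[X in X <= _]addr0.
have := trace_mul_tr_ge0 (v *m X); rewrite -(lerD2l (\tr (c *: (v *m v^T)))).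
move=> /le_trans; apply; rewrite -linearD /= [(v *m X)^T]trmx_mul.
have -> : c *: (v *m v^T) + v *m X *m (X^T *m v^T) = v *m (c%:M + X *m X^T) *m v^T.
  by rewrite mulmxDr mulmxDl mul_mx_scalar -scalemxAl !mulmxA.
by rewrite vG mul0mx linear0.
Qed.

(** With [G := X^T *m X], the matrix [X *m invmx G *m X^T] is the orthogonal
projector on the column space of [X]. The matrix [E] below is [B] composed with
it, and has the same Frobenius norm as [A] because [G] commutes with [A]; the
cross terms take the same value, so the difference of the two traces is the
squared Frobenius norm of [B - E]. *)
Lemma trace_intertwiner a b (A : 'M[F]_a) (B : 'M[F]_b) (X : 'M[F]_(b, a)) :
  X^T *m X \in unitmx -> B *m X = X *m A -> X^T *m B = A *m X^T ->
  \tr (A *m A^T) <= \tr (B *m B^T).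
Proof.
set G := X^T *m X => uG BX XB.
pose D := B - X *m A *m invmx G *m X^T.
have GA : G *m A = A *m G by rewrite /G -mulmxA -BX mulmxA XB mulmxA.
have GT : G^T = G by rewrite trmx_mul trmxK.
have := trace_mul_tr_ge0 D.
suff -> : \tr (D *m D^T) = \tr (B *m B^T) - \tr (A *m A^T) by rewrite subr_ge0.
set E := X *m A *m invmx G *m X^T in D *.
have trY : \tr (X *m A *m invmx G *m A^T *m X^T) = \tr (A *m A^T).
  by rewrite mxtrace_mulC !mulmxA -/G GA mulmxK.
have EBT : E *m B^T = X *m A *m invmx G *m A^T *m X^T.
  by rewrite -!mulmxA -!trmx_mul BX.
have EET : E *m E^T = X *m A *m invmx G *m A^T *m X^T.
  rewrite /E !trmx_mul trmxK trmx_inv GT -!mulmxA [X^T *m (X *m _)]mulmxA -/G.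
  by rewrite [G *m (invmx G *m _)]mulmxA mulmxV // mul1mx.
have BET : \tr (B *m E^T) = \tr (A *m A^T).
  by rewrite -mxtrace_tr trmx_mul trmxK EBT.
rewrite linearB /= mulmxBr !mulmxBl !linearB /= BET EBT EET trY.
by rewrite subrr subr0.
Qed.

End Trace.

(** * The matrices of squared minors *)

Section Discrepancy.

Variables (R : realType) (n : nat).
Implicit Types (U : 'M[R[i]]_n) (I J K L : {set 'I_n}).

Definition minor_sqr U r I J : R :=
  ComplexField.Normc.normc (setminor r U I J) ^+ 2.

Lemma minor_sqrE U r I J : (minor_sqr U r I J)%:C = `|setminor r U I J| ^+ 2.
Proof. by rewrite rmorphXn. Qed.

Lemma minor_sqr_tr U r I J : #|I| = r -> #|J| = r ->
  minor_sqr U^T r I J = minor_sqr U r J I.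
Proof. by move=> cI cJ; rewrite /minor_sqr setminor_tr. Qed.

Lemma minor_sqr_intertwining U r I J : U \is unitarymx ->
  #|I| = r -> #|J| = r.+1 ->
  \sum_(K : {set 'I_n} | (#|K| == r.+1) && (I \subset K)) minor_sqr U r.+1 K J =
  \sum_(L : {set 'I_n} | (#|L| == r) && (L \subset J)) minor_sqr U r I L.
Proof.
move=> U_unitary cI cJ; apply: (@complexI R); rewrite !rmorph_sum /=.
under eq_bigr => K _ do rewrite minor_sqrE.
under [RHS]eq_bigr => L _ do rewrite minor_sqrE.
exact: minor_intertwining.
Qed.

Lemma minor_sqrC U r I J : U \is unitarymx -> (r <= n)%N ->
  #|I| = r -> #|J| = r ->
  minor_sqr U r I J = minor_sqr U (n - r) (~: I) (~: J).
Proof.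
move=> U_unitary rn cI cJ; apply: (@complexI R); rewrite !minor_sqrE.
by congr (_ ^+ 2); apply: norm_setminorC => //; rewrite subnKC.
Qed.

Lemma minor_sqr0 U : minor_sqr U 0 set0 set0 = 1.
Proof.
apply: (@complexI R); rewrite minor_sqrE (setminorE _ (cards0 _) (cards0 _)).
by rewrite det_mx00 normr1 expr1n.
Qed.

(** Double counting: summing the intertwining relation over all [I] multiplies
the column sum at level [r.+1] by [r.+1] on the left, and gives [r.+1] column
sums of level [r] on the right. *)
Lemma sum_minor_sqr_col U r J : U \is unitarymx -> #|J| = r ->
  \sum_(I : {set 'I_n} | #|I| == r) minor_sqr U r I J = 1.
Proof.
move=> U_unitary; elim: r => [|r IHr] in J *.
  move=> /cards0_eq ->; rewrite (big_pred1 set0) => [|I]; first exact: minor_sqr0.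
  by rewrite cards_eq0.
move=> cJ; have r1 : r.+1%:R != 0 :> R by rewrite pnatr_eq0.
apply: (mulfI r1); rewrite mulr1.
transitivity (\sum_(I : {set 'I_n} | #|I| == r)
   \sum_(K : {set 'I_n} | (#|K| == r.+1) && (I \subset K)) minor_sqr U r.+1 K J).
  rewrite (exchange_big_dep (fun K : {set 'I_n} => #|K| == r.+1)) /=; last first.
    by move=> I K _ /andP[].
  rewrite mulr_sumr; apply: eq_bigr => K cK.
  rewrite (eq_bigl (fun I : {set 'I_n} => (#|I| == r) && (I \subset K))); last first.
    by move=> I; rewrite cK.
  by rewrite (sum_cocovers _ (eqP cK)) sumr_const (eqP cK) mulr_natl.
transitivity (\sum_(I : {set 'I_n} | #|I| == r)
   \sum_(L : {set 'I_n} | (#|L| == r) && (L \subset J)) minor_sqr U r I L).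
  by apply: eq_bigr => I /eqP cI; apply: minor_sqr_intertwining.
rewrite exchange_big /=.
rewrite (eq_bigr (fun=> 1)) => [|L /andP[/eqP cL _]]; last exact: IHr.
by rewrite (sum_cocovers _ cJ) sumr_const cJ.
Qed.

Definition minor_mx U r : 'M[R]_#|layer n r| := layer_mx r r (minor_sqr U r).

Lemma minor_mx_tr U r : minor_mx U^T r = (minor_mx U r)^T.
Proof.
by apply/matrixP => i j; rewrite !mxE minor_sqr_tr //; apply: card_layer.
Qed.

Lemma incl_tr_minor_mx U r : U \is unitarymx ->
  (incl_mx R n r)^T *m minor_mx U r.+1 = minor_mx U r *m (incl_mx R n r)^T.
Proof.
move=> U_unitary; apply/matrixP => i j; rewrite !mxE.
have cI := card_layer i; have cJ := card_layer j.
have := minor_sqr_intertwining U_unitary cI cJ; rewrite !big_mkcondr /=.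
rewrite -!sum_layer => E.
transitivity (\sum_(k < #|layer n r.+1|)
   (if enum_val i \subset enum_val k
    then minor_sqr U r.+1 (enum_val k) (enum_val j) else 0)).
  by apply: eq_bigr => k _; rewrite !mxE; case: ifP; rewrite ?mul1r ?mul0r.
rewrite E; apply: eq_bigr => k _; rewrite !mxE.
by case: ifP; rewrite ?mulr1 ?mulr0.
Qed.

(** The transpose of [incl_tr_minor_mx] for the unitary matrix [U^T]. *)
Lemma minor_mx_incl U r : U \is unitarymx ->
  minor_mx U r.+1 *m incl_mx R n r = incl_mx R n r *m minor_mx U r.
Proof.
move=> U_unitary; apply: trmx_inj; rewrite !trmx_mul -!minor_mx_tr.
by apply: incl_tr_minor_mx; rewrite trmx_unitary.
Qed.

Lemma sum_minor_discrepancy U r : U \is unitarymx -> (r <= n)%N ->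
  \sum_(I : {set 'I_n} | #|I| == r) \sum_(J : {set 'I_n} | #|J| == r)
    (minor_sqr U r I J - ('C(n, r)%:R)^-1) ^+ 2 =
  \tr (minor_mx U r *m (minor_mx U r)^T) - 1.
Proof.
move=> U_unitary rn.
have N0 : 'C(n, r)%:R != 0 :> R by rewrite pnatr_eq0 -lt0n bin_gt0.
have cN : #|[pred I : {set 'I_n} | #|I| == r]| = 'C(n, r).
  by rewrite -[n in RHS]card_ord -card_draws; apply: eq_card => I; rewrite !inE.
rewrite exchange_big /=.
have -> : \tr (minor_mx U r *m (minor_mx U r)^T) =
    \sum_(J : {set 'I_n} | #|J| == r) \sum_(I : {set 'I_n} | #|I| == r)
      minor_sqr U r I J ^+ 2.
  rewrite mxtrace_mulC /mxtrace -sum_layer; apply: eq_bigr => j _.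
  rewrite mxE -sum_layer; apply: eq_bigr => i _.
  by rewrite !mxE -expr2.
have colE (J : {set 'I_n}) : #|J| == r ->
    \sum_(I : {set 'I_n} | #|I| == r) (minor_sqr U r I J - ('C(n, r)%:R)^-1) ^+ 2 =
    \sum_(I : {set 'I_n} | #|I| == r) minor_sqr U r I J ^+ 2 - ('C(n, r)%:R)^-1.
  move=> /eqP cJ; under eq_bigr => I _ do rewrite sqrrB.
  rewrite big_split sumrB /= sumrMnl -mulr_suml.
  rewrite (sum_minor_sqr_col U_unitary cJ) sumr_const cN mul1r.
  rewrite -[_ ^+ 2 *+ _]mulr_natr [_^-1 ^+ 2]expr2 mulfVK // mulr2n.
  by rewrite opprD addrA addrNK.
rewrite (eq_bigr _ colE) sumrB sumr_const cN; congr (_ - _).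
by rewrite -[_^-1 *+ _]mulr_natr mulVf.
Qed.

(** The convention [delta_0 = 0] agrees with the general formula, the only minor
of order 0 being 1. *)
Lemma minor_discrepancy_sum U r :
  minor_discrepancy U r =
  \sum_(I : {set 'I_n} | #|I| == r) \sum_(J : {set 'I_n} | #|J| == r)
    (minor_sqr U r I J - ('C(n, r)%:R)^-1) ^+ 2.
Proof.
rewrite /minor_discrepancy; case: eqP => // ->.
have D (I : {set 'I_n}) : (#|I| == 0%N) = (I == set0) by rewrite cards_eq0.
rewrite (big_pred1 set0) // (big_pred1 set0) // minor_sqr0 bin0 invr1.
by rewrite subrr expr0n.
Qed.

Lemma minor_discrepancy_trace U r : U \is unitarymx -> (r <= n)%N ->
  minor_discrepancy U r = \tr (minor_mx U r *m (minor_mx U r)^T) - 1.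
Proof.
by move=> Uu rn; rewrite minor_discrepancy_sum sum_minor_discrepancy.
Qed.

End Discrepancy.

(** * Monotonicity and symmetry of the discrepancy *)

Theorem theorem4p4 (R : realType) (n : nat) (n_ge4 : (4 <= n)%N)
    (U : 'M[R[i]]_n) (U_unitary : U \is unitarymx) :
  (forall r : nat, (1 <= r)%N -> (r.+1 <= n./2)%N ->
     minor_discrepancy U r <= minor_discrepancy U r.+1) /\
  (forall r : nat, (r <= n)%N ->
     minor_discrepancy U r = minor_discrepancy U (n - r)).
Proof.
split=> [[//|r] _ r_lt|r rn].
  have r2n : (r.+1.*2 < n)%N by rewrite geq_half_double doubleS in r_lt; apply: ltnW.
  have rn : (r.+2 <= n)%N.
    by apply: leq_trans r2n; rewrite -addnn ltnS leq_addr.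
  rewrite !minor_discrepancy_trace // 1?ltnW // lerD2r.
  apply: (trace_intertwiner (X := incl_mx R n r.+1)).
  - by rewrite gram_incl_mx shifted_gram_unit // subr_gt0 ltr_nat.
  - exact: minor_mx_incl.
  - exact: incl_tr_minor_mx.
rewrite !minor_discrepancy_sum bin_sub //.
have cC (I : {set 'I_n}) : (#|~: I| == n - r)%N = (#|I| == r).
  by rewrite cardsCs setCK card_ord eqn_sub2lE // -[n in leqRHS]card_ord max_card.
rewrite [RHS](reindex_inj (inv_inj (@setCK _))) /=.
apply: eq_big => [I|I cI]; first by rewrite cC.
rewrite [RHS](reindex_inj (inv_inj (@setCK _))) /=.
apply: eq_big => [J|J cJ]; first by rewrite cC.
by rewrite (minor_sqrC U_unitary rn (eqP cI) (eqP cJ)).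
Qed.
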